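(* Let $\mathcal{T}=\mathrm{Spec}\,\mathbb{C}[t_1,t_2,t_3,\Delta^{-1}]$ with $\Delta=27t_3^2-t_2^3$, let $\mathsf{v}$ be the Ramanujan vector field on $\mathcal{T}$, and consider the curve $$\Phi(\tau)=\left(\frac1{12}E_2(\tau),\ \frac1{12}E_4(\tau),\ \frac1{216}E_6(\tau)\right)$$ in $\mathcal{T}$, where $\tau$ is in the upper half-plane. Write $(-)'=\frac{1}{2\pi i}\frac{d}{d\tau}$. Then the Ramanujan system of differential equations for the Eisenstein series, $$E_2'=\frac{E_2^2-E_4}{12},\qquad E_4'=\frac{E_2E_4-E_6}{3},\qquad E_6'=\frac{E_2E_6-E_4^2}{2},$$ is equivalent to the condition that $\Phi$ is an integral curve of $\mathsf{v}$, i.e. $$\Phi'(\tau)=\mathsf{v}_{\Phi(\tau)}.$$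
   Context: $E_2,E_4,E_6$ are the normalized Eisenstein series (constant term $1$). Over $\mathcal{T}$ consider the family $\pi:\mathcal{E}\to\mathcal{T}$ of elliptic curves $zy^2=4(x-t_1z)^3-t_2z^2(x-t_1z)-t_3z^3$ in $\mathbb{P}^2\times\mathcal{T}$, the basis $\alpha=[dx/y]$, $\omega=[x\,dx/y]$ of the relative de Rham cohomology $H^1_{dR}(\mathcal{E}/\mathcal{T})$, and the Gauss--Manin connection $\nabla$ on it. In this basis (a known result of Movasati) $\nabla\begin{pmatrix}\alpha\\\omega\end{pmatrix}=A\begin{pmatrix}\alpha\\\omega\end{pmatrix}$ with $$A=\frac1\Delta\begin{pmatrix}-\frac32t_1\theta-\frac1{12}d\Delta&\frac32\theta\\ \Delta\,dt_1-\frac16t_1d\Delta-\left(\frac32t_1^2+\frac18t_2\right)\theta&\frac32t_1\theta+\frac1{12}d\Delta\end{pmatrix},\qquad \theta=3t_3\,dt_2-2t_2\,dt_3 .$$ The Ramanujan vector field $\mathsf{v}$ is the (unique) vector field on $\mathcal{T}$ with $\nabla_{\mathsf{v}}\alpha=-\omega$ and $\nabla_{\mathsf{v}}\omega=0$. It is known to be $$\mathsf{v}=\left(t_1^2-\tfrac1{12}t_2\right)\frac{\partial}{\partial t_1}+(4t_1t_2-6t_3)\frac{\partial}{\partial t_2}+\left(6t_1t_3-\tfrac13t_2^2\right)\frac{\partial}{\partial t_3}.$$ *)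

(* Defs.v *)
From Stdlib Require Import Reals List.
From Coquelicot Require Import Coquelicot.

Open Scope C_scope.

(* The complex points of Spec C[t1,t2,t3,1/Delta].  The coordinate ring is
   reduced, so its elements are identified below with functions on these points. *)
Record T : Type := mkT {
  t1 : C;
  t2 : C;
  t3 : C;
  T_disc : 27 * t3 ^ 2 - t2 ^ 3 <> 0
}.

Definition Delta (p : T) : C := 27 * t3 p ^ 2 - t2 p ^ 3.

(* The C-subalgebra of functions on [S] generated by [gens]. *)
Inductive generated {S : Type} (gens : (S -> C) -> Prop) : (S -> C) -> Prop :=
| gen_const (c : C) : generated gens (fun _ => c)
| gen_gens (f : S -> C) : gens f -> generated gens f
| gen_add (f g : S -> C) :
    generated gens f -> generated gens g -> generated gens (fun s => f s + g s)
| gen_mul (f g : S -> C) :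
    generated gens f -> generated gens g -> generated gens (fun s => f s * g s).

Definition gens_T (f : T -> C) : Prop :=
  f = t1 \/ f = t2 \/ f = t3 \/ f = (fun p => / Delta p).

Definition regular_T : (T -> C) -> Prop := generated gens_T.

(* The tangent sheaf of [T] is free on d/dt1, d/dt2, d/dt3; the fields [v1], [v2],
   [v3] are the components in this frame. *)
Record vector_field : Type := mkVF {
  v1 : T -> C;
  v2 : T -> C;
  v3 : T -> C;
  v1_regular : regular_T v1;
  v2_regular : regular_T v2;
  v3_regular : regular_T v3
}.

(* The complement U of the zero section [0:1:0] in the family E -> T, i.e. its
   chart z = 1.  U is affine over T, and restriction
   H^1_dR(E/T) -> H^1_dR(U/T) is an isomorphism compatible with the Gauss-Manin
   connections (only one section is removed); the classes [dx/y] and [x dx/y] are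
   those of the corresponding forms on U. *)
Record U : Type := mkU {
  base : T;
  xU : C;
  yU : C;
  U_eq : yU ^ 2 = 4 * (xU - t1 base) ^ 3 - t2 base * (xU - t1 base) - t3 base
}.

Definition gens_U (f : U -> C) : Prop :=
  (exists a : T -> C, gens_T a /\ f = (fun u => a (base u))) \/ f = xU \/ f = yU.

Definition regular_U : (U -> C) -> Prop := generated gens_U.

(* [D] is only constrained on regular functions; its values elsewhere are
   irrelevant. *)
Definition derivation_U (D : (U -> C) -> (U -> C)) : Prop :=
  (forall f, regular_U f -> regular_U (D f)) /\
  (forall c u, D (fun _ => c) u = 0) /\
  (forall f g, regular_U f -> regular_U g ->
    forall u, D (fun w => f w + g w) u = D f u + D g u) /\
  (forall f g, regular_U f -> regular_U g ->
    forall u, D (fun w => f w * g w) u = D f u * g u + f u * D g u).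

(* The vector field of U/T dual to dx/y.  With P the cubic in the equation of U,
   2 y dy = P'(x) dx relatively to T, so dx/y = 2 dy/P'(x) generates the relative
   1-forms and the relative differential of g is X(g) dx/y. *)
Definition dual_field (X : (U -> C) -> (U -> C)) : Prop :=
  derivation_U X /\
  (forall u, X (fun w => t1 (base w)) u = 0) /\
  (forall u, X (fun w => t2 (base w)) u = 0) /\
  (forall u, X (fun w => t3 (base w)) u = 0) /\
  (forall u, X xU u = yU u) /\
  (forall u, X yU u = (12 * (xU u - t1 (base u)) ^ 2 - t2 (base u)) / 2).

Definition lifts (v : vector_field) (D : (U -> C) -> (U -> C)) : Prop :=
  derivation_U D /\
  (forall u, D (fun w => t1 (base w)) u = v1 v (base u)) /\
  (forall u, D (fun w => t2 (base w)) u = v2 v (base u)) /\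
  (forall u, D (fun w => t3 (base w)) u = v3 v (base u)).

(* [gauss_manin v s s'] : nabla_v [s dx/y] = [s' dx/y] in H^1_dR(U/T), for regular
   functions s and s' on U.
   The Gauss-Manin connection is computed by the Lie derivative along any lift D
   of v to U.  Since [D,X] kills functions from T, it equals h X for some regular
   h; as dx/y is dual to X, L_D(dx/y) = - h dx/y, hence
   L_D(s dx/y) = (D s - h s) dx/y.  Two relative forms are cohomologous when they
   differ by an exact form X(g) dx/y. *)
Definition gauss_manin (v : vector_field) (s s' : U -> C) : Prop :=
  exists (X D : (U -> C) -> (U -> C)) (h g : U -> C),
    dual_field X /\ lifts v D /\ regular_U h /\ regular_U g /\
    (forall f, regular_U f -> forall u, D (X f) u - X (D f) u = h u * X f u) /\
    (forall u, D s u - h u * s u = s' u + X g u).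

(* nabla_v alpha = - omega and nabla_v omega = 0, where alpha = [dx/y] and
   omega = [x dx/y]. *)
Definition is_Ramanujan_vector_field (v : vector_field) : Prop :=
  gauss_manin v (fun _ => 1) (fun u => - xU u) /\
  gauss_manin v xU (fun _ => 0).

Definition upper_half_plane (tau : C) : Prop := (0 < Im tau)%R.

(* q = exp (2 pi i tau). *)
Definition nome (tau : C) : C :=
  RtoC (exp (- (2 * PI * Im tau)))
  * (cos (2 * PI * Re tau)%R, sin (2 * PI * Re tau)%R).

Definition sigma (k n : nat) : nat :=
  list_sum (map (fun d => Nat.pow d k)
    (filter (fun d => Nat.eqb (Nat.modulo n d) 0) (seq 1 n))).

Definition CSeries (a : nat -> C) : C :=
  (Series (fun n => Re (a n)), Series (fun n => Im (a n))).

(* sum over n >= 1 of sigma_k(n) q^n *)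
Definition divisor_series (k : nat) (tau : C) : C :=
  CSeries (fun n => RtoC (INR (sigma k (S n))) * nome tau ^ S n).

Definition E2 (tau : C) : C := 1 - 24 * divisor_series 1 tau.
Definition E4 (tau : C) : C := 1 + 240 * divisor_series 3 tau.
Definition E6 (tau : C) : C := 1 - 504 * divisor_series 5 tau.

(* f is complex differentiable at tau and (1 / (2 pi i)) f'(tau) = l *)
Definition is_qderive (f : C -> C) (tau l : C) : Prop :=
  @is_derive C_AbsRing C_NormedModule f tau (2 * RtoC PI * Ci * l).

Definition Ramanujan_system : Prop :=
  forall tau, upper_half_plane tau ->
    is_qderive E2 tau ((E2 tau ^ 2 - E4 tau) / 12) /\
    is_qderive E4 tau ((E2 tau * E4 tau - E6 tau) / 3) /\
    is_qderive E6 tau ((E2 tau * E6 tau - E4 tau ^ 2) / 2).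

Definition Phi (tau : C) : C * C * C :=
  (E2 tau / 12, E4 tau / 12, E6 tau / 216).

(* gamma, given in the coordinates (t1, t2, t3), maps the upper half-plane to [T]
   and gamma' = v_gamma there. *)
Definition is_integral_curve (v : vector_field) (gamma : C -> C * C * C) : Prop :=
  forall tau, upper_half_plane tau ->
    exists p : T, gamma tau = (t1 p, t2 p, t3 p) /\
      is_qderive (fun z => fst (fst (gamma z))) tau (v1 v p) /\
      is_qderive (fun z => snd (fst (gamma z))) tau (v2 v p) /\
      is_qderive (fun z => snd (gamma z)) tau (v3 v p).

(* Main.v *)
(** On a fiber of the family, a regular function is [A + B y] with [A] and [B]
    polynomials in [x = xU - t1], and [y^2 = P x] with [P] cubic.  Comparing the parts
    that are even and odd in [y], the two conditions on [nabla_v] become linear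
    differential equations [2 P w' - P' w + R = 0] for a polynomial [w], where [R]
    depends only on [t1], [t2], [t3] and on the components of [v].  Degree
    considerations bound the degree of [w], and the remaining coefficients determine
    [w] and then [v], which makes the two systems proportional component by component.

    That [Phi] lands in [T] means that [E4^3 - E6^2] has no zero.  It satisfies
    [(E4^3 - E6^2)' = E2 (E4^3 - E6^2)], so a zero would propagate up a vertical line,
    contradicting [E4^3 - E6^2 = 1728 q + O(q^2)]. *)

Require Import Defs.
From Stdlib Require Import Reals List Lra Lia FunctionalExtensionality.
From Coquelicot Require Import Coquelicot.

Open Scope C_scope.

(** * Polynomials as lists of coefficients *)

Fixpoint peval (l : list C) (x : C) : C :=
  match l with
  | nil => 0
  | a :: m => a + x * peval m x
  end.

Definition coef (l : list C) (k : nat) : C := nth k l 0.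

Fixpoint padd (l m : list C) : list C :=
  match l, m with
  | nil, _ => m
  | _, nil => l
  | a :: l', b :: m' => (a + b) :: padd l' m'
  end.

Definition pscale (c : C) (l : list C) : list C := map (fun a => c * a) l.

Fixpoint pmul (l m : list C) : list C :=
  match l with
  | nil => nil
  | a :: l' => padd (pscale a m) (RtoC 0 :: pmul l' m)
  end.

(** Follows (a + x m)' = m + x m', so no index has to be carried along. *)
Fixpoint pderiv (l : list C) : list C :=
  match l with
  | nil => nil
  | _ :: m => padd m (RtoC 0 :: pderiv m)
  end.

Lemma peval_add l m x : peval (padd l m) x = peval l x + peval m x.
Proof.
revert m; induction l as [|a l IH]; intros [|b m]; simpl; try ring.
rewrite IH; ring.
Qed.

Lemma peval_scale c l x : peval (pscale c l) x = c * peval l x.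
Proof. induction l as [|a l IH]; simpl; [|fold (pscale c l); rewrite IH]; ring. Qed.

Lemma peval_mul l m x : peval (pmul l m) x = peval l x * peval m x.
Proof.
induction l as [|a l IH]; simpl; [ring|].
rewrite peval_add, peval_scale; simpl; rewrite IH; ring.
Qed.

Lemma peval_deriv_add l m x :
  peval (pderiv (padd l m)) x = peval (pderiv l) x + peval (pderiv m) x.
Proof.
revert m; induction l as [|a l IH]; intros [|b m]; simpl; try ring.
rewrite !peval_add; simpl; rewrite IH; ring.
Qed.

Lemma peval_deriv_scale c l x :
  peval (pderiv (pscale c l)) x = c * peval (pderiv l) x.
Proof.
induction l as [|a l IH]; simpl; [ring|]; fold (pscale c l).
rewrite !peval_add, peval_scale; simpl; rewrite IH; ring.
Qed.

Lemma peval_deriv_mul l m x :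
  peval (pderiv (pmul l m)) x
  = peval (pderiv l) x * peval m x + peval l x * peval (pderiv m) x.
Proof.
induction l as [|a l IH]; simpl; [ring|].
rewrite peval_deriv_add, peval_deriv_scale, !peval_add; simpl.
rewrite peval_add; simpl; rewrite IH, peval_mul; ring.
Qed.

Lemma coef_nil k : coef nil k = 0.
Proof. now destruct k. Qed.

Lemma coef_add l m k : coef (padd l m) k = coef l k + coef m k.
Proof.
unfold coef; revert m k; induction l as [|a l IH]; intros [|b m] [|k]; simpl;
  try ring; apply IH.
Qed.

Lemma coef_scale c l k : coef (pscale c l) k = c * coef l k.
Proof.
unfold coef, pscale; revert k; induction l as [|a l IH]; intros [|k]; simpl;
  try ring; apply IH.
Qed.

Lemma coef_cons_S a l k : coef (a :: l) (S k) = coef l k.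
Proof. reflexivity. Qed.

Lemma coef_cons_0 a l : coef (a :: l) 0 = a.
Proof. reflexivity. Qed.

Lemma coef_deriv l k : coef (pderiv l) k = RtoC (INR (S k)) * coef l (S k).
Proof.
revert k; induction l as [|a l IH]; intros k.
- now rewrite !coef_nil, Cmult_0_r.
- simpl pderiv; rewrite coef_add, coef_cons_S.
  destruct k as [|k].
  + rewrite coef_cons_0; simpl; ring.
  + rewrite coef_cons_S, IH, (S_INR (S k)), RtoC_plus; ring.
Qed.

Lemma coef_overflow l k : (length l <= k)%nat -> coef l k = 0.
Proof. apply nth_overflow. Qed.

Lemma peval_bounded l :
  exists M, (0 <= M)%R /\ forall x, (Cmod x <= 1)%R -> (Cmod (peval l x) <= M)%R.
Proof.
induction l as [|a l [M [HM H]]].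
- exists 0%R; split; [lra|]; intros x _; simpl; rewrite Cmod_0; lra.
- exists (Cmod a + M)%R; split; [generalize (Cmod_ge_0 a); lra|].
  intros x Hx; simpl.
  apply Rle_trans with (1 := Cmod_triangle _ _); rewrite Cmod_mult.
  specialize (H x Hx).
  generalize (Cmod_ge_0 x), (Cmod_ge_0 (peval l x)); nra.
Qed.

(** Letting x tend to 0 kills the constant coefficient; what remains is x times the tail, and x can
    be cancelled. Excluding x = 0 from the hypothesis is what lets the induction pass to the
    tail. *)
Lemma coef_eq_0_of_peval l : (forall x : C, x <> 0 -> peval l x = 0) -> forall k, coef l k = 0.
Proof.
induction l as [|a l IH]; intros H k; [apply coef_nil|].
assert (Ha : a = 0).
{ destruct (peval_bounded l) as [M [HM HB]].
  destruct (Req_dec (Cmod a) 0) as [E|E]; [now apply Cmod_eq_0|].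
  pose proof (Cmod_ge_0 a).
  (* A small real point: the vanishing at [e] gives |a| <= e M, whereas e (|a| + M + 1) = |a| makes
     e M smaller than |a| when a is nonzero. *)
  set (e := (Cmod a / (Cmod a + M + 1))%R).
  assert (He : (0 < e)%R) by (apply Rdiv_lt_0_compat; lra).
  assert (He1 : (e * (Cmod a + M + 1) = Cmod a)%R) by (unfold e; field; lra).
  assert (Hc : Cmod (RtoC e) = e) by (rewrite Cmod_R; apply Rabs_pos_eq; lra).
  assert (Hz : RtoC e <> 0) by (intros K; apply RtoC_inj in K; lra).
  specialize (H _ Hz); simpl in H.
  assert (H' : a = - (RtoC e * peval l (RtoC e)))
    by (rewrite <- (Cplus_0_r a), <- (Cplus_opp_r (RtoC e * peval l (RtoC e))),
          Cplus_assoc, H; ring).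
  apply (f_equal Cmod) in H'; rewrite Cmod_opp, Cmod_mult, Hc in H'.
  assert (e <= 1)%R by nra.
  specialize (HB (RtoC e)); rewrite Hc in HB; specialize (HB H1).
  nra. }
destruct k as [|k]; [exact Ha|].
rewrite coef_cons_S; apply IH; intros x Hx.
specialize (H x Hx); simpl in H; rewrite Ha, Cplus_0_l in H.
destruct (Ceq_dec (peval l x) 0) as [E|E]; [exact E|].
now elim (Cmult_neq_0 _ _ Hx E).
Qed.

(** * The Ramanujan vector field *)

Lemma Csqrt_exists (z : C) : exists w, w * w = z.
Proof.
destruct z as [a b].
set (r := sqrt (a * a + b * b)).
assert (Hr : (r * r = a * a + b * b)%R) by (apply sqrt_sqrt; nra).
assert (Hr0 : (0 <= r)%R) by apply sqrt_pos.
assert (H1 : (0 <= (r + a) / 2)%R) by nra.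
assert (H2 : (0 <= (r - a) / 2)%R) by nra.
pose proof (sqrt_sqrt _ H1) as S1; pose proof (sqrt_sqrt _ H2) as S2.
pose proof (sqrt_pos ((r + a) / 2)) as P1; pose proof (sqrt_pos ((r - a) / 2)) as P2.
set (u := sqrt ((r + a) / 2)) in *; set (w := sqrt ((r - a) / 2)) in *.
assert (HH : ((2 * (u * w)) * (2 * (u * w)) = b * b)%R)
  by (replace ((2 * (u * w)) * (2 * (u * w)))%R with (4 * (u * u) * (w * w))%R by ring;
      rewrite S1, S2; field_simplify; nra).
assert (Hp : (0 <= u * w)%R) by (apply Rmult_le_pos; assumption).
(* Here u w = |b| / 2, so the sign of b decides the sign of the imaginary part. *)
destruct (Rle_dec 0 b).
- exists (u, w); unfold Cmult; simpl; f_equal; nra.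
- exists (u, (- w)%R); unfold Cmult; simpl; f_equal; nra.
Qed.

(** * Fibers of the family in the centred coordinate [xi], and parity in y *)

Definition cubic (p : T) (x : C) : C := 4 * x ^ 3 - t2 p * x - t3 p.
Definition cubic' (p : T) (x : C) : C := 12 * x ^ 2 - t2 p.
Definition pcubic (p : T) : list C := - t3 p :: - t2 p :: RtoC 0 :: RtoC 4 :: nil.

Lemma peval_pcubic p x : peval (pcubic p) x = cubic p x.
Proof. unfold cubic; simpl; ring. Qed.

Lemma peval_deriv_pcubic p x : peval (pderiv (pcubic p)) x = cubic' p x.
Proof. unfold cubic'; simpl; ring. Qed.

Definition xi (u : U) : C := xU u - t1 (base u).

(** Every x lifts to two points (x, y) and (x, -y) of the fiber, and half the sum and half the
    difference of the two identities separate the parts. The odd part keeps the factor [cubic p x]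
    because y may vanish. *)
Lemma even_odd_parts (p : T) (A B A' B' : C -> C) :
  (forall u, base u = p -> A (xi u) + B (xi u) * yU u = A' (xi u) + B' (xi u) * yU u) ->
  forall x, A x = A' x /\ cubic p x * B x = cubic p x * B' x.
Proof.
intros H x.
destruct (Csqrt_exists (cubic p x)) as [y Hy].
assert (HU : forall z, z * z = cubic p x ->
  A x + B x * z = A' x + B' x * z).
{ intros z Hz.
  assert (E : z ^ 2 = 4 * (x + t1 p - t1 p) ^ 3 - t2 p * (x + t1 p - t1 p) - t3 p).
  { replace (x + t1 p - t1 p) with x by ring.
    fold (cubic p x); rewrite <- Hz; ring. }
  specialize (H (mkU p (x + t1 p) z E) eq_refl); unfold xi in H; simpl in H.
  now replace (x + t1 p - t1 p) with x in H by ring. }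
pose proof (HU y Hy) as H1.
assert (H2 : A x + B x * - y = A' x + B' x * - y) by (apply HU; rewrite <- Hy; ring).
split.
- replace (A x) with (((A x + B x * y) + (A x + B x * - y)) / 2) by field.
  rewrite H1, H2; field.
- rewrite <- Hy.
  (* Only y B is determined by the half difference; multiplying it by y avoids dividing by y at the
     roots of the cubic. *)
  replace (y * y * B x) with (y * (((A x + B x * y) - (A x + B x * - y)) / 2)) by field.
  rewrite H1, H2; field.
Qed.

Lemma U_eq_cubic u : yU u * yU u = cubic (base u) (xi u).
Proof.
transitivity (yU u ^ 2); [ring|]; rewrite (U_eq u); reflexivity.
Qed.

(** * Regular functions and derivations on [U] *)

Lemma gen_ext {S : Type} (gens : (S -> C) -> Prop) (f g : S -> C) :
  generated gens f -> (forall s, f s = g s) -> generated gens g.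
Proof. intros H E; now replace g with f by now apply functional_extensionality. Qed.

Lemma regular_U_t1 : regular_U (fun u => t1 (base u)).
Proof. apply gen_gens; left; exists t1; split; [now left|reflexivity]. Qed.

Lemma regular_U_t2 : regular_U (fun u => t2 (base u)).
Proof. apply gen_gens; left; exists t2; split; [now right; left|reflexivity]. Qed.

Lemma regular_U_t3 : regular_U (fun u => t3 (base u)).
Proof. apply gen_gens; left; exists t3; split; [now right; right; left|reflexivity]. Qed.

Lemma regular_U_inv_Delta : regular_U (fun u => / Defs.Delta (base u)).
Proof.
apply gen_gens; left; exists (fun p => / Defs.Delta p); split; [now right; right; right|reflexivity].
Qed.

Lemma regular_U_x : regular_U xU.
Proof. apply gen_gens; now right; left. Qed.

Lemma regular_U_y : regular_U yU.
Proof. apply gen_gens; now right; right. Qed.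

Section Derivation.

Variables (D : (U -> C) -> (U -> C)) (HD : derivation_U D).

Lemma derivation_regular f : regular_U f -> regular_U (D f).
Proof. apply HD. Qed.

Lemma derivation_const c u : D (fun _ => c) u = 0.
Proof. apply HD. Qed.

Lemma derivation_add f g u : regular_U f -> regular_U g ->
  D (fun w => f w + g w) u = D f u + D g u.
Proof. intros Hf Hg; now apply HD. Qed.

Lemma derivation_mul f g u : regular_U f -> regular_U g ->
  D (fun w => f w * g w) u = D f u * g u + f u * D g u.
Proof. intros Hf Hg; now apply HD. Qed.

Lemma derivation_ext f g u : (forall w, f w = g w) -> D f u = D g u.
Proof. intros E; now replace g with f by now apply functional_extensionality. Qed.

Lemma derivation_scal c f u : regular_U f -> D (fun w => c * f w) u = c * D f u.
Proof.
intros Hf; rewrite (derivation_mul (fun _ => c) f), derivation_const; auto.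
- ring.
- apply gen_const.
Qed.

Lemma derivation_cube f u : regular_U f ->
  D (fun w => f w * (f w * f w)) u = 3 * f u ^ 2 * D f u.
Proof.
intros Hf.
rewrite (derivation_mul f (fun w => f w * f w)), (derivation_mul f f); auto.
- ring.
- now apply gen_mul.
Qed.

(** Apply D to f (1/f) = 1 and solve for D (1/f). *)
Lemma derivation_inv f u : regular_U f -> regular_U (fun w => / f w) ->
  (forall w, f w <> 0) -> D (fun w => / f w) u = - D f u / f u ^ 2.
Proof.
intros Hf Hi Hn.
assert (E : D (fun w => f w * / f w) u = 0).
{ rewrite <- (derivation_const 1 u); apply derivation_ext; intros w; field; apply Hn. }
rewrite derivation_mul in E by assumption.
replace (D (fun w => / f w) u)
  with ((D f u * / f u + f u * D (fun w => / f w) u - D f u * / f u) / f u)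
  by (field; apply Hn).
rewrite E; field; apply Hn.
Qed.

Lemma derivation_Delta u :
  D (fun w => Defs.Delta (base w)) u
  = 54 * t3 (base u) * D (fun w => t3 (base w)) u
    - 3 * t2 (base u) ^ 2 * D (fun w => t2 (base w)) u.
Proof.
pose proof regular_U_t2 as R2; pose proof regular_U_t3 as R3.
(* Differences and powers are first written with sums, products and constants, the only operations
   in [generated] and [derivation_U]. *)
rewrite (derivation_ext _
  (fun w => 27 * (t3 (base w) * t3 (base w))
            + (-1) * (t2 (base w) * (t2 (base w) * t2 (base w)))))
  by (intros w; unfold Defs.Delta; ring).
rewrite (derivation_add (fun w => 27 * (t3 (base w) * t3 (base w)))
  (fun w => (-1) * (t2 (base w) * (t2 (base w) * t2 (base w))))).
2: { apply gen_mul; [apply gen_const|]; now apply gen_mul. }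
2: { apply gen_mul; [apply gen_const|]; apply gen_mul; [|apply gen_mul]; assumption. }
rewrite (derivation_scal 27 (fun w => t3 (base w) * t3 (base w))) by now apply gen_mul.
rewrite (derivation_scal (-1) (fun w => t2 (base w) * (t2 (base w) * t2 (base w))))
  by (apply gen_mul; [|apply gen_mul]; assumption).
rewrite (derivation_cube (fun w => t2 (base w))) by assumption.
rewrite (derivation_mul (fun w => t3 (base w)) (fun w => t3 (base w))) by assumption.
ring.
Qed.

(** This is D applied to both sides of y^2 = 4 xi^3 - t2 xi - t3, with the terms coming from the
    base kept because D need not kill t1, t2, t3. *)
Lemma derivation_curve u :
  2 * yU u * D yU u
  = cubic' (base u) (xi u) * (D xU u - D (fun w => t1 (base w)) u)
    - xi u * D (fun w => t2 (base w)) u - D (fun w => t3 (base w)) u.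
Proof.
pose proof regular_U_t1 as R1; pose proof regular_U_t2 as R2; pose proof regular_U_t3 as R3.
pose proof regular_U_x as Rx; pose proof regular_U_y as Ry.
assert (Rn : forall f : U -> C, regular_U f -> regular_U (fun w => (-1) * f w))
  by (intros f Hf; apply gen_mul; [apply gen_const|exact Hf]).
assert (Rz : regular_U xi)
  by (apply (gen_ext gens_U (fun u => xU u + (-1) * t1 (base u)));
      [apply gen_add; [exact Rx|now apply Rn]|intros w; unfold xi; ring]).
assert (Dz : D xi u = D xU u - D (fun w => t1 (base w)) u).
{ rewrite (derivation_ext _ (fun w => xU w + (-1) * t1 (base w))) by (intros w; unfold xi; ring).
  rewrite (derivation_add xU (fun w => (-1) * t1 (base w))) by auto.
  rewrite (derivation_scal (-1) (fun w => t1 (base w))) by auto; ring. }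
assert (Rm : regular_U (fun w => t2 (base w) * xi w)) by now apply gen_mul.
assert (R4 : regular_U (fun w => 4 * (xi w * (xi w * xi w)))).
{ apply gen_mul; [apply gen_const|]; apply gen_mul; [|apply gen_mul]; assumption. }
assert (E : D (fun w => yU w * yU w) u
  = D (fun w => 4 * (xi w * (xi w * xi w))
        + ((-1) * (t2 (base w) * xi w) + (-1) * t3 (base w))) u).
{ apply derivation_ext; intros w; rewrite U_eq_cubic; unfold cubic; ring. }
rewrite (derivation_mul yU yU) in E by assumption.
rewrite (derivation_add (fun w => 4 * (xi w * (xi w * xi w)))
  (fun w => (-1) * (t2 (base w) * xi w) + (-1) * t3 (base w))) in E.
2: exact R4.
2: apply gen_add; now apply Rn.
rewrite (derivation_add (fun w => (-1) * (t2 (base w) * xi w))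
  (fun w => (-1) * t3 (base w))) in E by now apply Rn.
rewrite (derivation_scal 4 (fun w => xi w * (xi w * xi w))) in E
  by (apply gen_mul; [|apply gen_mul]; assumption).
rewrite (derivation_cube xi) in E by assumption.
rewrite (derivation_scal (-1) (fun w => t2 (base w) * xi w)) in E by assumption.
rewrite (derivation_scal (-1) (fun w => t3 (base w))) in E by assumption.
rewrite (derivation_mul (fun w => t2 (base w)) xi) in E by assumption.
rewrite Dz in E; unfold cubic'.
transitivity (D yU u * yU u + yU u * D yU u); [ring|rewrite E; ring].
Qed.

End Derivation.

(* [X (A + B y) = A' y + B' y^2 + B P'/2], where [y^2 = P]. *)
Lemma regular_U_on_fiber X p f : dual_field X -> regular_U f ->
  exists A B : list C, forall u, base u = p ->
    f u = peval A (xi u) + peval B (xi u) * yU u /\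
    X f u = (peval (pderiv B) (xi u) * cubic p (xi u)
             + peval B (xi u) * cubic' p (xi u) / 2)
            + peval (pderiv A) (xi u) * yU u.
Proof.
intros [HX [X1 [X2 [X3 [Xx Xy]]]]] Hf.
(* Functions pulled back from the base are constant on the fiber and killed by X, so they all take A
   constant and B = 0. *)
assert (Hc : forall c (f : U -> C), (forall u, X f u = 0) ->
  (forall u, base u = p -> f u = c) ->
  exists A B : list C, forall u, base u = p ->
    f u = peval A (xi u) + peval B (xi u) * yU u /\
    X f u = (peval (pderiv B) (xi u) * cubic p (xi u)
             + peval B (xi u) * cubic' p (xi u) / 2)
            + peval (pderiv A) (xi u) * yU u).
{ intros c g H0 H1; exists (c :: nil), nil; intros u Hu.
  rewrite H0, H1 by assumption; simpl; split; field. }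
induction Hf as [c|f Hf|f g Hf [A1 [B1 IH1]] Hg [A2 [B2 IH2]]
                  |f g Hf [A1 [B1 IH1]] Hg [A2 [B2 IH2]]].
- apply (Hc c); intros u; [now apply derivation_const|reflexivity].
- destruct Hf as [[a [[-> | [-> | [-> | ->]]] ->]]|[-> | ->]].
  + apply (Hc (t1 p)); intros u; [apply X1|now intros ->].
  + apply (Hc (t2 p)); intros u; [apply X2|now intros ->].
  + apply (Hc (t3 p)); intros u; [apply X3|now intros ->].
  + apply (Hc (/ Defs.Delta p)); intros u; [|now intros ->].
    rewrite (derivation_inv X HX (fun u => Defs.Delta (base u))), derivation_Delta, X2, X3.
    * field; apply T_disc.
    * exact HX.
    * pose proof regular_U_t2; pose proof regular_U_t3.
      apply (gen_ext gens_U (fun w => 27 * (t3 (base w) * t3 (base w))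
            + (-1) * (t2 (base w) * (t2 (base w) * t2 (base w))))).
      2: intros w; unfold Defs.Delta; ring.
      apply gen_add; apply gen_mul; [apply gen_const| |apply gen_const|];
        repeat apply gen_mul; assumption.
    * apply regular_U_inv_Delta.
    * intros w; apply T_disc.
  + exists (t1 p :: RtoC 1 :: nil), nil; intros u <-; rewrite Xx; unfold xi; simpl; split; field.
  + exists nil, (RtoC 1 :: nil); intros u <-; rewrite Xy; unfold cubic', xi; simpl; split; field.
- exists (padd A1 A2), (padd B1 B2); intros u Hu.
  rewrite (derivation_add X HX) by assumption.
  destruct (IH1 u Hu) as [E1 F1], (IH2 u Hu) as [E2 F2].
  rewrite F1, F2, E1, E2, !peval_add, !peval_deriv_add; split; field.
(* Expand (A1 + B1 y)(A2 + B2 y) and replace y^2 by the cubic. *)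
- exists (padd (pmul A1 A2) (pmul (pcubic p) (pmul B1 B2))),
    (padd (pmul A1 B2) (pmul A2 B1)); intros u Hu.
  rewrite (derivation_mul X HX) by assumption.
  destruct (IH1 u Hu) as [E1 F1], (IH2 u Hu) as [E2 F2].
  rewrite F1, F2, E1, E2, !peval_add, !peval_deriv_add, !peval_deriv_mul, !peval_mul,
    peval_pcubic, peval_deriv_pcubic.
  pose proof (U_eq_cubic u) as HU; rewrite Hu in HU; rewrite <- HU.
  split; field.
Qed.

(** Write D x = a0 + a1 y, D y = b0 + b1 y and h = h0 + h1 y on the fiber. As X x = y, the bracket
    relation at x reads D y - X (D x) = h y, whose odd part gives P (b1 - a0') = P h0.
    Differentiating the curve along D gives 2 P b1 as its even part. Eliminating b1 leaves a formula
    for h0. *)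
Lemma lift_bracket_even_part v X D h p :
  dual_field X -> lifts v D -> regular_U h ->
  (forall f, regular_U f -> forall u, D (X f) u - X (D f) u = h u * X f u) ->
  exists a0 a1 h0 h1 : list C,
    (forall u, base u = p -> D xU u = peval a0 (xi u) + peval a1 (xi u) * yU u) /\
    (forall u, base u = p -> h u = peval h0 (xi u) + peval h1 (xi u) * yU u) /\
    forall x, 2 * cubic p x * peval h0 x
      = cubic' p x * (peval a0 x - v1 v p) - v2 v p * x - v3 v p
        - 2 * cubic p x * peval (pderiv a0) x.
Proof.
intros HX [HD [D1 [D2 D3]]] Hh Hc.
pose proof HX as [_ [_ [_ [_ [Xx _]]]]].
destruct (regular_U_on_fiber X p (D xU) HX
  (derivation_regular D HD _ regular_U_x)) as [a0 [a1 Ha]].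
destruct (regular_U_on_fiber X p (D yU) HX
  (derivation_regular D HD _ regular_U_y)) as [b0 [b1 Hb]].
destruct (regular_U_on_fiber X p h HX Hh) as [h0 [h1 HH]].
exists a0, a1, h0, h1; split; [now intros u Hu; apply Ha|].
split; [now intros u Hu; apply HH|]; intros x.
assert (Ey : X xU = yU) by now apply functional_extensionality.
destruct (even_odd_parts p
  (fun x => peval b0 x - (peval (pderiv a1) x * cubic p x + peval a1 x * cubic' p x / 2))
  (fun x => peval b1 x - peval (pderiv a0) x)
  (fun x => cubic p x * peval h1 x)
  (fun x => peval h0 x)) with (x := x) as [_ E1].
{ intros u Hu.
  pose proof (Hc xU regular_U_x u) as E; rewrite Ey in E.
  destruct (Ha u Hu) as [_ Fa], (Hb u Hu) as [Eb _], (HH u Hu) as [Eh _].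
  rewrite Fa, Eb, Eh in E.
  pose proof (U_eq_cubic u) as HU; rewrite Hu in HU; rewrite <- HU in *.
  transitivity ((peval h0 (xi u) + peval h1 (xi u) * yU u) * yU u);
    [rewrite <- E|]; ring. }
destruct (even_odd_parts p
  (fun x => 2 * (peval b1 x * cubic p x))
  (fun x => 2 * peval b0 x)
  (fun x => cubic' p x * (peval a0 x - v1 v p) - v2 v p * x - v3 v p)
  (fun x => cubic' p x * peval a1 x)) with (x := x) as [E2 _].
{ intros u Hu.
  pose proof (derivation_curve D HD u) as E.
  rewrite D1, D2, D3, Hu in E.
  destruct (Ha u Hu) as [Ea _], (Hb u Hu) as [Eb _].
  rewrite Ea, Eb in E.
  pose proof (U_eq_cubic u) as HU; rewrite Hu in HU; rewrite <- HU in *.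
  transitivity (2 * yU u * (peval b0 (xi u) + peval b1 (xi u) * yU u)); [ring|].
  rewrite E; ring. }
cbv beta in E1, E2.
rewrite <- E2.
transitivity (2 * (cubic p x * peval h0 x)); [ring|rewrite <- E1; ring].
Qed.

(* The two equations express that the classes of the Lie derivatives of [dx/y] and
   [x dx/y] are those of [- x dx/y] and [0]; the choice of the lift and of the exact
   form has been absorbed in [w]. *)
Lemma gauss_manin_alpha_equation v p : gauss_manin v (fun _ => 1) (fun u => - xU u) ->
  exists w : list C, forall x,
    2 * cubic p x * peval (pderiv w) x - cubic' p x * peval w x
    + (2 * cubic p x * (x + t1 p) + v2 v p * x + v3 v p) = 0.
Proof.
intros [X [D [h [g [HX [HD [Hh [Hg [Hc Hs]]]]]]]]].
destruct (lift_bracket_even_part v X D h p HX HD Hh Hc)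
  as [a0 [a1 [h0 [h1 [Ha [HH E]]]]]].
destruct (regular_U_on_fiber X p g HX Hg) as [G0 [G HG]].
(* The solution is w = a0 - v1 - G P: a0 - v1 is the even part of D applied to x - t1, and G, the
   coefficient of y in g, accounts for the exact form X g. *)
exists (padd a0 (padd (- v1 v p :: nil) (pscale (-1) (pmul G (pcubic p))))); intros x.
destruct (even_odd_parts p
  (fun x => - peval h0 x) (fun x => - peval h1 x)
  (fun x => - (x + t1 p) + (peval (pderiv G) x * cubic p x + peval G x * cubic' p x / 2))
  (fun x => peval (pderiv G0) x)) with (x := x) as [E1 _].
{ intros u Hu.
  specialize (Hs u); destruct HD as [HD _]; rewrite (derivation_const D HD) in Hs.
  rewrite (proj2 (HG u Hu)), (HH u Hu) in Hs.
  transitivity (0 - (peval h0 (xi u) + peval h1 (xi u) * yU u) * 1); [ring|].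
  rewrite Hs; unfold xi; rewrite Hu; ring. }
cbv beta in E1.
rewrite !peval_deriv_add, !peval_add, peval_deriv_scale, peval_scale, peval_deriv_mul,
  peval_mul, peval_deriv_pcubic, peval_pcubic; simpl.
assert (E2 : 2 * cubic p x * peval h0 x = 2 * cubic p x * (- - peval h0 x)) by ring.
rewrite E1, E in E2.
match type of E2 with ?L = ?R => transitivity (R - L) end; [field|rewrite E2; ring].
Qed.

Lemma gauss_manin_omega_equation v p : gauss_manin v xU (fun _ => 0) ->
  exists w : list C, forall x,
    2 * cubic p x * peval (pderiv w) x - cubic' p x * peval w x
    + (2 * cubic p x * v1 v p + (v2 v p * x + v3 v p) * (x + t1 p)) = 0.
Proof.
intros [X [D [h [g [HX [HD [Hh [Hg [Hc Hs]]]]]]]]].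
destruct (lift_bracket_even_part v X D h p HX HD Hh Hc)
  as [a0 [a1 [h0 [h1 [Ha [HH E]]]]]].
destruct (regular_U_on_fiber X p g HX Hg) as [G0 [G HG]].
(* The solution is now w = (a0 - v1)(x + t1) - G P; the factor x + t1 is [xU] written in the centred
   coordinate. *)
exists (padd (pmul (padd a0 (- v1 v p :: nil)) (t1 p :: RtoC 1 :: nil))
  (pscale (-1) (pmul G (pcubic p)))); intros x.
destruct (even_odd_parts p
  (fun x => peval a0 x - peval h0 x * (x + t1 p))
  (fun x => peval a1 x - peval h1 x * (x + t1 p))
  (fun x => peval (pderiv G) x * cubic p x + peval G x * cubic' p x / 2)
  (fun x => peval (pderiv G0) x)) with (x := x) as [E1 _].
{ intros u Hu.
  specialize (Hs u).
  rewrite (proj2 (HG u Hu)), (HH u Hu), (Ha u Hu) in Hs.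
  rewrite Cplus_0_l in Hs; rewrite <- Hs; unfold xi; rewrite Hu; ring. }
cbv beta in E1.
rewrite peval_deriv_add, !peval_add, peval_deriv_scale, peval_scale, !peval_deriv_mul,
  !peval_mul, peval_deriv_add, peval_add, peval_deriv_pcubic, peval_pcubic; simpl.
assert (E2 : 2 * cubic p x * peval h0 x * (x + t1 p)
  = 2 * cubic p x * peval a0 x
    - 2 * cubic p x * (peval a0 x - peval h0 x * (x + t1 p))) by ring.
rewrite E1, E in E2.
match type of E2 with ?L = ?R => transitivity (R - L) end; [field|rewrite E2; ring].
Qed.

(** * Polynomial solutions w of 2 P w' - P' w + R = 0 *)

Lemma cubic_ode_coef p (w r : list C) :
  (forall x, 2 * cubic p x * peval (pderiv w) x - cubic' p x * peval w x + peval r x = 0) ->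
  t2 p * coef w 0 - 2 * t3 p * coef w 1 + coef r 0 = 0 /\
  - t2 p * coef w 1 - 4 * t3 p * coef w 2 + coef r 1 = 0 /\
  forall n, (8 * RtoC (INR n) - 12) * coef w n
    = (2 * RtoC (INR n) + 3) * t2 p * coef w (n + 2)
      + 2 * (RtoC (INR n) + 3) * t3 p * coef w (n + 3) - coef r (n + 2).
Proof.
intros H.
set (e := padd (padd (pscale 2 (pmul (pcubic p) (pderiv w)))
                     (pscale (-1) (pmul (- t2 p :: RtoC 0 :: RtoC 12 :: nil) w))) r).
assert (He : forall k, coef e k = 0).
{ apply coef_eq_0_of_peval; intros x _.
  unfold e; rewrite !peval_add, !peval_scale, !peval_mul, peval_pcubic.
  apply (eq_trans (y := 2 * cubic p x * peval (pderiv w) x - cubic' p x * peval w x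
    + peval r x)); [unfold cubic'; simpl; ring|apply H]. }
assert (Hk : forall k, coef e k
  = 2 * coef (pmul (pcubic p) (pderiv w)) k
    - coef (pmul (- t2 p :: RtoC 0 :: RtoC 12 :: nil) w) k + coef r k).
{ intros k; unfold e; rewrite !coef_add, !coef_scale; ring. }
split; [|split].
- apply (fun H => eq_trans H (He 0%nat)); rewrite Hk; unfold pcubic, pmul.
  rewrite !coef_add, !coef_scale, !coef_cons_0, coef_deriv; simpl; ring.
- apply (fun H => eq_trans H (He 1%nat)); rewrite Hk; unfold pcubic, pmul.
  rewrite !coef_add, !coef_scale, !coef_cons_S, !coef_add, !coef_scale, !coef_cons_0,
    !coef_deriv; simpl; rewrite ?RtoC_plus; ring.
(* Degree n + 2 of the equation: the terms 4 x^3 of P and 12 x^2 of P' contribute (8 n - 12) w_n,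
   and lower terms of P involve only w_(n+2) and w_(n+3). *)
- intros n.
  pose proof (He (n + 2)%nat) as E; rewrite Hk in E.
  replace (n + 2)%nat with (S (S n)) in * by lia.
  replace (n + 3)%nat with (S (S (S n))) by lia.
  (* Coefficient n of x w', in a form that also covers n = 0, where the shifted list starts with
     0. *)
  assert (Hd : coef (RtoC 0 :: pderiv w) n = RtoC (INR n) * coef w n).
  { destruct n as [|n]; [rewrite coef_cons_0; simpl; ring|].
    now rewrite coef_cons_S, coef_deriv. }
  unfold pcubic, pmul in E.
  rewrite !coef_add, !coef_scale, !coef_cons_S, !coef_add, !coef_scale, !coef_cons_S,
    !coef_add, !coef_scale, !coef_deriv in E.
  destruct n as [|n].
  + rewrite !coef_cons_0 in E; rewrite !S_INR, !RtoC_plus in E; simpl in E |- *.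
    match type of E with ?L = _ =>
      match goal with |- ?A = ?B => transitivity (B + L); [|rewrite E; ring] end end; ring.
  + rewrite !coef_cons_S, coef_add, coef_scale, coef_deriv in E.
    assert (H0 : coef (RtoC 0 :: nil) n = 0)
      by (destruct n; [reflexivity|now rewrite coef_cons_S, coef_nil]).
    rewrite H0, coef_nil in E.
    repeat rewrite S_INR, RtoC_plus in E; repeat rewrite S_INR, RtoC_plus.
    match type of E with ?L = _ =>
      match goal with |- ?A = ?B => transitivity (B + L); [|rewrite E; ring] end end. ring.
Qed.

(** Strong induction on the distance k below the bound L, since each step looks two and three places
    up. *)
Lemma vanish_downward (c : nat -> C) (N L : nat) :
  (forall n, (L <= n)%nat -> c n = 0) ->
  (forall n, (N <= n)%nat -> c (n + 2)%nat = 0 -> c (n + 3)%nat = 0 -> c n = 0) ->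
  forall n, (N <= n)%nat -> c n = 0.
Proof.
intros HL Hs.
assert (H : forall k n, (L <= n + k)%nat -> (N <= n)%nat -> c n = 0).
{ induction k as [k IH] using (well_founded_induction Nat.lt_wf_0); intros n Hk Hn.
  destruct (Nat.le_gt_cases L n) as [H|H]; [now apply HL|].
  apply Hs; [exact Hn| |]; apply (IH (k - 1)%nat); lia. }
intros n; apply (H L); lia.
Qed.

(** Parity: equality would mean 2 n = 3. *)
Lemma eight_n_minus_12_neq_0 n : 8 * RtoC (INR n) - 12 <> 0.
Proof.
rewrite <- RtoC_mult, <- RtoC_minus; intros E; apply RtoC_inj in E.
assert (H : INR (2 * n) = INR 3) by (rewrite mult_INR; simpl; lra).
apply INR_eq in H; lia.
Qed.

(** The degree bound for w. Above the degree of R the recursion is homogeneous with nonzero leading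
    factor 8 n - 12, so vanishing descends from the end of the list [w]. *)
Lemma cubic_ode_coef_vanish p (w r : list C) N :
  (forall x, 2 * cubic p x * peval (pderiv w) x - cubic' p x * peval w x + peval r x = 0) ->
  (length r <= N + 2)%nat ->
  forall n, (N <= n)%nat -> coef w n = 0.
Proof.
intros H Hr.
apply vanish_downward with (length w); [intros n; apply coef_overflow|].
intros n Hn E2 E3.
destruct (cubic_ode_coef p w r H) as [_ [_ Hc]].
specialize (Hc n); rewrite E2, E3, (coef_overflow r) in Hc by lia.
destruct (Ceq_dec (coef w n) 0) as [E|E]; [exact E|].
elim (Cmult_neq_0 _ _ (eight_n_minus_12_neq_0 n) E); rewrite Hc; ring.
Qed.

Lemma Ceq_of_scaled (k a b : C) : k <> 0 -> k * (a - b) = 0 -> a = b.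
Proof.
intros Hk H.
replace a with (k * (a - b) / k + b) by (field; exact Hk).
rewrite H; field; exact Hk.
Qed.

(** The condition on alpha determines v2 and v3; with these known, the condition on omega determines
    v1. *)
Lemma Ramanujan_vector_field_formula v p : is_Ramanujan_vector_field v ->
  v1 v p = t1 p ^ 2 - t2 p / 12 /\
  v2 v p = 4 * t1 p * t2 p - 6 * t3 p /\
  v3 v p = 6 * t1 p * t3 p - t2 p ^ 2 / 3.
Proof.
intros [Ha Ho].
assert (H23 : v2 v p = 4 * t1 p * t2 p - 6 * t3 p /\
              v3 v p = 6 * t1 p * t3 p - t2 p ^ 2 / 3).
{ destruct (gauss_manin_alpha_equation v p Ha) as [w Hw].
  set (r := padd (pscale 2 (pmul (pcubic p) (t1 p :: RtoC 1 :: nil)))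
                 (v3 v p :: v2 v p :: nil)).
  assert (H : forall x,
    2 * cubic p x * peval (pderiv w) x - cubic' p x * peval w x + peval r x = 0).
  { intros x; apply (fun H => eq_trans H (Hw x)); unfold r.
    rewrite peval_add, peval_scale, peval_mul, peval_pcubic; simpl; ring. }
  (* R has degree 4, so w has degree at most 2. Degrees 4, 3, 2 give its coefficients in turn, and
     degrees 1 and 0 then give v2 and v3. *)
  pose proof (cubic_ode_coef_vanish p w r 3 H ltac:(simpl; lia)) as Hv.
  destruct (cubic_ode_coef p w r H) as [E0 [E1 En]].
  pose proof (En 0%nat) as E2; pose proof (En 1%nat) as E3; pose proof (En 2%nat) as E4.
  simpl Nat.add in *.
  rewrite ?(Hv 3%nat), ?(Hv 4%nat), ?(Hv 5%nat) in * by lia.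
  clear Hv En H Hw; unfold r, coef in *; simpl in *.
  assert (C2 : nth 2 w 0 = -2).
  { apply (Ceq_of_scaled 4); [intros K; apply RtoC_inj in K; lra|].
    rewrite RtoC_plus in E4.
    match type of E4 with ?L = ?R => transitivity (L - R) end; [ring|rewrite E4; ring]. }
  assert (C1 : nth 1 w 0 = 2 * t1 p).
  { apply (Ceq_of_scaled (-4)); [intros K; apply RtoC_inj in K; lra|].
    match type of E3 with ?L = ?R => transitivity (L - R) end; [ring|rewrite E3; ring]. }
  assert (C0 : nth 0 w 0 = t2 p / 3).
  { apply (Ceq_of_scaled (-12)); [intros K; apply RtoC_inj in K; lra|].
    rewrite C2 in E2.
    match type of E2 with ?L = ?R => transitivity (L - R) end; [field|rewrite E2; ring]. }
  rewrite C0, C1, C2 in *.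
  split.
  - apply (Ceq_of_scaled 1); [intros K; apply RtoC_inj in K; lra|].
    apply (fun H => eq_trans H E1); ring.
  - apply (Ceq_of_scaled 1); [intros K; apply RtoC_inj in K; lra|].
    apply (fun H => eq_trans H E0); field. }
destruct H23 as [H2 H3]; split; [|now split].
destruct (gauss_manin_omega_equation v p Ho) as [w Hw].
set (r := padd (pscale (2 * v1 v p) (pcubic p))
               (pmul (v3 v p :: v2 v p :: nil) (t1 p :: RtoC 1 :: nil))).
assert (H : forall x,
  2 * cubic p x * peval (pderiv w) x - cubic' p x * peval w x + peval r x = 0).
{ intros x; apply (fun H => eq_trans H (Hw x)); unfold r.
  rewrite peval_add, peval_scale, peval_mul, peval_pcubic; simpl; ring. }
(* R has degree at most 3, so w is at most linear; degrees 3 and 2 give its coefficients in terms of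
   v1 and v2. *)
pose proof (cubic_ode_coef_vanish p w r 2 H ltac:(simpl; lia)) as Hv.
destruct (cubic_ode_coef p w r H) as [E0 [E1 En]].
pose proof (En 0%nat) as E2; pose proof (En 1%nat) as E3.
simpl Nat.add in *.
rewrite ?(Hv 2%nat), ?(Hv 3%nat), ?(Hv 4%nat) in * by lia.
clear Hv En H Hw; unfold r, coef in *; simpl in *.
assert (C1 : nth 1 w 0 = 2 * v1 v p).
{ apply (Ceq_of_scaled (-4)); [intros K; apply RtoC_inj in K; lra|].
  match type of E3 with ?L = ?R => transitivity (L - R) end; [ring|rewrite E3; ring]. }
assert (C0 : nth 0 w 0 = v2 v p / 12).
{ apply (Ceq_of_scaled (-12)); [intros K; apply RtoC_inj in K; lra|].
  match type of E2 with ?L = ?R => transitivity (L - R) end; [field|rewrite E2; field]. }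
rewrite C0, C1, H2, H3 in *.
assert (F2 : t2 p * (v1 v p - (t1 p ^ 2 - t2 p / 12)) = 0).
{ apply (Ceq_of_scaled (-4)); [intros K; apply RtoC_inj in K; lra|].
  apply (fun H => eq_trans H E1); field. }
(* The degree 1 equation gives v1 only up to the factor t2. Where t2 = 0, the discriminant forces t3
   to be nonzero and the degree 0 equation is used instead. *)
destruct (Ceq_dec (t2 p) 0) as [Z2|Z2]; [|now apply (Ceq_of_scaled (t2 p))].
assert (Z3 : t3 p <> 0) by (intros Z3; apply (T_disc p); rewrite Z2, Z3; ring).
apply (Ceq_of_scaled (-6 * t3 p)).
- apply Cmult_neq_0; [intros K; apply RtoC_inj in K; lra|exact Z3].
- rewrite Z2 in E0 |- *; apply (fun H => eq_trans H E0); field.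
Qed.

(** * The discriminant of the Eisenstein series *)

Lemma im_le_Cmod (z : C) : (Rabs (Im z) <= Cmod z)%R.
Proof.
apply Rsqr_incr_0_var; [|apply Cmod_ge_0].
rewrite <- Rsqr_abs; unfold Rsqr; pose proof (Cmod2_alt z); nra.
Qed.

Lemma Cmod_le_re_im (z : C) : (Cmod z <= Rabs (Re z) + Rabs (Im z))%R.
Proof.
apply Rsqr_incr_0_var; [|generalize (Rabs_pos (Re z)), (Rabs_pos (Im z)); lra].
unfold Rsqr; pose proof (Cmod2_alt z) as H.
generalize (Rabs_pos (Re z)), (Rabs_pos (Im z)).
pose proof (pow2_abs (Re z)); pose proof (pow2_abs (Im z)); nra.
Qed.

(** A vertical increment h of the imaginary part is the complex increment i h, whence the factor
    [Ci]. *)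
Lemma is_derive_vertical (f : C -> C) (x y : R) (l : C) :
  @is_derive C_AbsRing C_NormedModule f (x, y) l ->
  is_derive (fun s : R => Re (f (x, s))) y (Re (Ci * l)) /\
  is_derive (fun s : R => Im (f (x, s))) y (Im (Ci * l)).
Proof.
intros [_ H].
assert (Hd : forall eps, (0 < eps)%R -> exists d : posreal, forall h : R, h <> 0%R ->
  (Rabs h < d)%R ->
  (Cmod (f (x, y + h)%R - f (x, y) - RtoC h * (Ci * l)) <= eps * Rabs h)%R).
{ intros eps Heps.
  destruct (H (x, y) (fun P HP => HP) (mkposreal eps Heps)) as [d Hd].
  exists d; intros h _ Hh.
  assert (E : minus ((x, y + h)%R : C) (x, y) = RtoC h * Ci).
  { unfold minus, plus, opp; simpl; unfold Cplus, Copp, Cmult, RtoC, Ci; simpl; f_equal; ring. }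
  assert (Eh : Cmod (RtoC h * Ci) = Rabs h).
  { rewrite Cmod_mult, Cmod_R, Cmod_Ci; ring. }
  specialize (Hd (x, y + h)%R).
  replace (RtoC h * (Ci * l)) with (RtoC h * Ci * l) by ring.
  rewrite <- Eh, <- E.
  apply Hd.
  change (Cmod (minus ((x, y + h)%R : C) (x, y)) < d)%R.
  now rewrite E, Eh. }
(* Halving eps turns the non-strict bound on the remainder into the strict one required for real
   derivatives. *)
split; apply is_derive_Reals; intros eps Heps;
  destruct (Hd (eps / 2)%R ltac:(lra)) as [d Hd']; exists d; intros h Hh Hhd;
  specialize (Hd' h Hh Hhd);
  set (z := f (x, y + h)%R - f (x, y) - RtoC h * (Ci * l)) in *;
  assert (Ha : (0 < Rabs h)%R) by now apply Rabs_pos_lt.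
- assert (E : ((Re (f (x, (y + h)%R)) - Re (f (x, y))) / h - Re (Ci * l))%R = (Re z / h)%R)
    by (unfold z; destruct (f (x, (y + h)%R)), (f (x, y)), l; simpl; field; exact Hh).
  rewrite E; clear E.
  unfold Rdiv; rewrite Rabs_mult, Rabs_inv.
  apply Rmult_lt_reg_r with (Rabs h); [exact Ha|].
  rewrite Rmult_assoc, Rinv_l by lra.
  pose proof (re_le_Cmod z); nra.
- assert (E : ((Im (f (x, (y + h)%R)) - Im (f (x, y))) / h - Im (Ci * l))%R = (Im z / h)%R)
    by (unfold z; destruct (f (x, (y + h)%R)), (f (x, y)), l; simpl; field; exact Hh).
  rewrite E; clear E.
  unfold Rdiv; rewrite Rabs_mult, Rabs_inv.
  apply Rmult_lt_reg_r with (Rabs h); [exact Ha|].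
  rewrite Rmult_assoc, Rinv_l by lra.
  pose proof (im_le_Cmod z); nra.
Qed.

(** A Gronwall argument: if M is the maximum of c on [a, b], then N(y) exp(-M y) has nonpositive
    derivative and starts at 0, so N(b) <= 0. *)
Lemma linear_ode_zero (N c : R -> R) (a b : R) :
  (a <= b)%R ->
  (forall y, (a <= y <= b)%R -> is_derive N y (c y * N y)%R) ->
  (forall y, (a <= y <= b)%R -> continuity_pt c y) ->
  (forall y, (a <= y <= b)%R -> (0 <= N y)%R) ->
  N a = 0%R -> N b = 0%R.
Proof.
intros Hab HN Hc Hp H0.
destruct (continuity_ab_maj c a b Hab Hc) as [m [Hm _]].
set (M := c m) in *.
assert (HF : forall y, (a <= y <= b)%R ->
  is_derive (fun y => N y * exp (- (M * y)))%R y ((c y - M) * N y * exp (- (M * y)))%R).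
{ intros y Hy; specialize (HN y Hy).
  auto_derive; [now exists (c y * N y)%R|].
  rewrite (is_derive_unique (fun x : R => N x) _ _ HN); ring. }
destruct (MVT_gen (fun y => N y * exp (- (M * y)))%R a b
  (fun y => (c y - M) * N y * exp (- (M * y)))%R) as [z [Hz E]].
- rewrite Rmin_left, Rmax_right by assumption; intros y Hy; apply HF; lra.
- rewrite Rmin_left, Rmax_right by assumption; intros y Hy.
  apply derivable_continuous_pt; eexists; apply is_derive_Reals, HF, Hy.
- rewrite Rmin_left, Rmax_right in Hz by assumption.
  rewrite H0 in E.
  pose proof (exp_pos (- (M * z))) as Ez; pose proof (exp_pos (- (M * b))) as Eb.
  pose proof (Hm z Hz) as Hmz; pose proof (Hp z Hz) as Hpz.
  assert (Hb : (0 <= N b)%R) by (apply Hp; lra).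
  assert (K1 : ((c z - M) * N z <= 0)%R) by nra.
  assert (K2 : ((c z - M) * N z * exp (- (M * z)) <= 0)%R) by nra.
  assert (K3 : ((c z - M) * N z * exp (- (M * z)) * (b - a) <= 0)%R) by nra.
  nra.
Qed.

(** * The Eisenstein series near q = 0 *)

Lemma list_sum_le (B : nat) (l : list nat) :
  (forall d, In d l -> (d <= B)%nat) -> (list_sum l <= length l * B)%nat.
Proof.
induction l as [|a l IH]; intros H; simpl; [lia|].
assert (a <= B)%nat by (apply H; now left).
assert (list_sum l <= length l * B)%nat by (apply IH; intros d Hd; apply H; now right).
lia.
Qed.

(** A crude bound n^(k+1) <= n^6 <= (2^n)^6, enough to compare the divisor series with a geometric
    series of ratio 64 |q|. *)
Lemma sigma_le k n : (k <= 5)%nat -> (Defs.sigma k n <= 64 ^ n)%nat.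
Proof.
intros Hk; unfold Defs.sigma.
assert (H1 : (list_sum (map (fun d => d ^ k)%nat
  (filter (fun d => Nat.eqb (Nat.modulo n d) 0) (seq 1 n))) <= n * n ^ k)%nat).
{ eapply Nat.le_trans; [apply (list_sum_le (n ^ k))|].
  - intros d Hd; apply in_map_iff in Hd as [e [<- He]].
    apply filter_In in He as [He _]; apply in_seq in He.
    apply Nat.pow_le_mono_l; lia.
  - rewrite length_map; apply Nat.mul_le_mono_r.
    eapply Nat.le_trans; [apply filter_length_le|]; now rewrite length_seq. }
eapply Nat.le_trans; [exact H1|].
destruct n as [|n]; [simpl; lia|].
replace (S n * S n ^ k)%nat with (S n ^ S k)%nat by reflexivity.
eapply Nat.le_trans; [apply (Nat.pow_le_mono_r (S n) (S k) 6); lia|].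
replace 64%nat with (2 ^ 6)%nat by reflexivity.
rewrite <- Nat.pow_mul_r, Nat.mul_comm, Nat.pow_mul_r.
apply Nat.pow_le_mono_l, Nat.lt_le_incl, Nat.pow_gt_lin_r; lia.
Qed.

Lemma sigma_1 k : Defs.sigma k 1 = 1%nat.
Proof. unfold Defs.sigma; simpl; rewrite Nat.pow_1_l; reflexivity. Qed.

(** The terms after the first are dominated by a geometric series with sum s^2 / (1 - s), and s <=
    1/2 bounds this by 2 s^2. *)
Lemma Series_tail_bound (a : nat -> R) (s : R) :
  (0 <= s <= 1 / 2)%R -> (forall n, (Rabs (a n) <= s ^ S n)%R) ->
  (Rabs (Series a - a 0%nat) <= 2 * s ^ 2)%R.
Proof.
intros Hs Ha.
assert (Hg : Rabs s < 1) by (rewrite Rabs_pos_eq; lra).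
assert (Hex : ex_series (fun n => s ^ 2 * s ^ n)%R)
  by (exact (ex_series_scal_l (V := R_NormedModule) (s ^ 2)%R _ (ex_series_geom s Hg))).
assert (Hex0 : ex_series (fun n => s ^ S n)%R).
{ apply (ex_series_ext (fun n => s * s ^ n)%R); [reflexivity|].
  exact (ex_series_scal_l (V := R_NormedModule) s _ (ex_series_geom s Hg)). }
assert (Ha1 : forall n, (0 <= Rabs (a (S n)) <= s ^ 2 * s ^ n)%R).
{ intros n; split; [apply Rabs_pos|].
  eapply Rle_trans; [apply Ha|]; simpl; lra. }
rewrite Series_incr_1 by exact (ex_series_le a _ Ha Hex0).
replace (a 0%nat + Series (fun k => a (S k)) - a 0%nat)%R
  with (Series (fun k => a (S k))) by ring.
eapply Rle_trans; [apply Series_Rabs|].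
{ apply (ex_series_le (fun n => Rabs (a (S n))) (fun n => s ^ 2 * s ^ n)%R);
    [|exact Hex].
  intros n; change (Rabs (Rabs (a (S n))) <= s ^ 2 * s ^ n)%R.
  rewrite Rabs_Rabsolu; apply Ha1. }
eapply Rle_trans; [exact (Series_le _ _ Ha1 Hex)|].
rewrite Series_scal_l, Series_geom by exact Hg.
assert (/ (1 - s) <= 2)%R.
{ replace 2%R with (/ (1 / 2))%R by field; apply Rinv_le_contravar; lra. }
pose proof (pow2_ge_0 s); nra.
Qed.

Lemma Cmod_nome tau : Cmod (nome tau) = exp (- (2 * PI * Im tau)).
Proof.
unfold nome; rewrite Cmod_mult, Cmod_R, Rabs_pos_eq by apply Rlt_le, exp_pos.
assert (H : Cmod (cos (2 * PI * Re tau), sin (2 * PI * Re tau))%R = 1%R).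
{ unfold Cmod; simpl fst; simpl snd.
  rewrite Rplus_comm, <- !Rsqr_pow2, sin2_cos2; apply sqrt_1. }
rewrite H; ring.
Qed.

(** The tail bound with s = 64 |q| is applied to real and imaginary parts separately. The threshold
    1/128 makes s <= 1/2, and 16384 is 2 times 2 times 64^2. *)
Lemma divisor_series_near_infinity k tau : (k <= 5)%nat ->
  (Cmod (nome tau) <= 1 / 128)%R ->
  (Cmod (divisor_series k tau - nome tau) <= 16384 * Cmod (nome tau) ^ 2)%R.
Proof.
intros Hk Hr; set (q := nome tau) in *.
set (a := fun n => RtoC (INR (Defs.sigma k (S n))) * q ^ S n).
assert (Ha : forall n, (Cmod (a n) <= (64 * Cmod q) ^ S n)%R).
{ intros n; unfold a; rewrite Cmod_mult, Cmod_pow, Cmod_R, Rabs_pos_eq by apply pos_INR.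
  rewrite Rpow_mult_distr; apply Rmult_le_compat_r; [apply pow_le, Cmod_ge_0|].
  replace (64 ^ S n)%R with (INR (64 ^ S n)) by (rewrite pow_INR; f_equal; simpl; lra).
  apply le_INR, sigma_le, Hk. }
assert (Ha0 : a 0%nat = q).
{ unfold a; rewrite sigma_1; simpl; ring. }
pose proof (Cmod_ge_0 q).
assert (HR := Series_tail_bound (fun n => Re (a n)) (64 * Cmod q) ltac:(lra)
  (fun n => Rle_trans _ _ _ (re_le_Cmod (a n)) (Ha n))).
assert (HI := Series_tail_bound (fun n => Im (a n)) (64 * Cmod q) ltac:(lra)
  (fun n => Rle_trans _ _ _ (im_le_Cmod (a n)) (Ha n))).
cbv beta in HR, HI; rewrite Ha0 in HR, HI.
eapply Rle_trans; [apply Cmod_le_re_im|].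
replace (16384 * Cmod q ^ 2)%R
  with (2 * (64 * Cmod q) ^ 2 + 2 * (64 * Cmod q) ^ 2)%R by ring.
now apply Rplus_le_compat.
Qed.

Lemma discriminant_near_infinity : exists eps : R, (0 < eps)%R /\
  forall tau, (Cmod (nome tau) < eps)%R -> E4 tau ^ 3 - E6 tau ^ 2 <> 0.
Proof.
set (K := 16384%R).
(* Bounds every term of E4^3 - E6^2 beyond 1728 q by M |q|^2: 1728 = 720 + 1008 collects the linear
   errors, and 172800 = 3 240^2, 254016 = 504^2, 13824000 = 240^3 come from the expansion. *)
set (M := (1728 * K + (172800 + 254016) * (1 + K) ^ 2 + 13824000 * (1 + K) ^ 3)%R).
assert (HM : (1 < M)%R) by (unfold M, K; lra).
exists (/ M / 128)%R; split; [apply Rdiv_lt_0_compat; [apply Rinv_0_lt_compat|]; lra|].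
intros tau Hq E.
assert (HiM : (/ M < 1)%R) by (rewrite <- Rinv_1; apply Rinv_lt_contravar; lra).
assert (Hr : (Cmod (nome tau) <= 1 / 128)%R) by lra.
pose proof (divisor_series_near_infinity 3 tau ltac:(lia) Hr) as H3.
pose proof (divisor_series_near_infinity 5 tau ltac:(lia) Hr) as H5.
unfold E4, E6 in E.
set (q := nome tau) in *; fold K in H3, H5.
set (e3 := divisor_series 3 tau - q) in *; set (e5 := divisor_series 5 tau - q) in *.
replace (divisor_series 3 tau) with (q + e3) in E by (unfold e3; ring).
replace (divisor_series 5 tau) with (q + e5) in E by (unfold e5; ring).
set (r := Cmod q) in *.
assert (Hr0 : (0 < r)%R) by (unfold r, q; rewrite Cmod_nome; apply exp_pos).
assert (HS : forall e, (Cmod e <= K * r ^ 2)%R -> (Cmod (q + e) <= (1 + K) * r)%R).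
{ intros e He; eapply Rle_trans; [apply Cmod_triangle|]; fold r.
  assert (r ^ 2 <= r)%R by nra; unfold K in *; nra. }
pose proof (HS e3 H3) as S3; pose proof (HS e5 H5) as S5.
set (s3 := q + e3) in *; set (s5 := q + e5) in *.
assert (Eq : 1728 * q = - (720 * e3 + 1008 * e5 + 172800 * s3 ^ 2 + 13824000 * s3 ^ 3
                          + - (254016 * s5 ^ 2))).
{ apply (Ceq_of_scaled 1); [intros Z; apply RtoC_inj in Z; lra|].
  apply (fun H => eq_trans H E); unfold s3, s5; ring. }
apply (f_equal Cmod) in Eq.
rewrite Cmod_opp, Cmod_mult, Cmod_R, Rabs_pos_eq in Eq by lra; fold r in Eq.
assert (Hc : forall (c : R) z, (0 <= c)%R -> Cmod (RtoC c * z) = (c * Cmod z)%R)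
  by (intros c z Hc; now rewrite Cmod_mult, Cmod_R, Rabs_pos_eq).
assert (B : (1728 * r <= 720 * Cmod e3 + 1008 * Cmod e5 + 172800 * Cmod s3 ^ 2
  + 13824000 * Cmod s3 ^ 3 + 254016 * Cmod s5 ^ 2)%R).
{ rewrite Eq; repeat (eapply Rle_trans; [apply Cmod_triangle|]; apply Rplus_le_compat);
    rewrite ?Cmod_opp, Hc, ?Cmod_pow by lra; lra. }
assert (P3 : (Cmod s3 ^ 2 <= ((1 + K) * r) ^ 2)%R)
  by (apply pow_incr; split; [apply Cmod_ge_0|exact S3]).
assert (P5 : (Cmod s5 ^ 2 <= ((1 + K) * r) ^ 2)%R)
  by (apply pow_incr; split; [apply Cmod_ge_0|exact S5]).
assert (Q3 : (Cmod s3 ^ 3 <= ((1 + K) * r) ^ 3)%R)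
  by (apply pow_incr; split; [apply Cmod_ge_0|exact S3]).
rewrite Rpow_mult_distr in P3, P5, Q3.
assert (R3 : (r ^ 3 <= r ^ 2)%R) by (simpl; nra).
assert (Q3' : (Cmod s3 ^ 3 <= (1 + K) ^ 3 * r ^ 2)%R).
{ eapply Rle_trans; [exact Q3|]; apply Rmult_le_compat_l; [|exact R3].
  apply pow_le; unfold K; lra. }
(* A zero of the discriminant would give 1728 r <= M r^2, which is impossible once M r < 1. *)
assert (B2 : (1728 * r <= M * r ^ 2)%R) by (unfold M; lra).
assert (B3 : (1728 <= M * r)%R)
  by (apply Rmult_le_reg_r with r; [exact Hr0|]; simpl in B2; lra).
assert (M * r < 1)%R.
{ replace 1%R with (M * / M)%R by (field; lra); apply Rmult_lt_compat_l; lra. }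
lra.
Qed.

Lemma nome_small (eps y0 : R) : (0 < eps)%R ->
  exists y, (y0 <= y)%R /\ forall x : R, (Cmod (nome (x, y)) < eps)%R.
Proof.
intros He; exists (Rmax y0 (1 + Rabs (ln eps)))%R; split; [apply Rmax_l|]; intros x.
rewrite Cmod_nome; simpl Im.
rewrite <- (exp_ln eps) at 2 by exact He; apply exp_increasing.
pose proof (Rmax_r y0 (1 + Rabs (ln eps))) as Hm.
set (y := Rmax y0 (1 + Rabs (ln eps))) in *.
pose proof PI2_1; pose proof (Rle_abs (- ln eps)) as Hl; rewrite Rabs_Ropp in Hl.
pose proof (Rabs_pos (ln eps)); nra.
Qed.

(** * Propagation of a zero of the discriminant along a vertical line *)

Definition re_sqr (a b : R) : R := (a * a - b * b)%R.
Definition im_sqr (a b : R) : R := (2 * a * b)%R.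
Definition re_cube (a b : R) : R := (a * re_sqr a b - b * im_sqr a b)%R.
Definition im_cube (a b : R) : R := (a * im_sqr a b + b * re_sqr a b)%R.

(** With d = (a + i b)^3 - (c + i e)^2, this is (|d|^2)' = 2 Re(conj(d) d') in real coordinates,
    where a + i b and c + i e stand for E4 and E6. *)
Lemma is_derive_discriminant_norm2 (a b c e : R -> R) (y a' b' c' e' : R) :
  is_derive a y a' -> is_derive b y b' -> is_derive c y c' -> is_derive e y e' ->
  is_derive (fun s => (re_cube (a s) (b s) - re_sqr (c s) (e s)) ^ 2
                      + (im_cube (a s) (b s) - im_sqr (c s) (e s)) ^ 2)%R y
    (2 * ((re_cube (a y) (b y) - re_sqr (c y) (e y))
          * (3 * (re_sqr (a y) (b y) * a' - im_sqr (a y) (b y) * b')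
             - 2 * (c y * c' - e y * e'))
        + (im_cube (a y) (b y) - im_sqr (c y) (e y))
          * (3 * (re_sqr (a y) (b y) * b' + im_sqr (a y) (b y) * a')
             - 2 * (c y * e' + e y * c'))))%R.
Proof.
intros Ha Hb Hc He; unfold re_cube, im_cube, re_sqr, im_sqr.
auto_derive; [repeat split; eexists; eassumption|].
rewrite (is_derive_unique (fun x : R => a x) _ _ Ha), (is_derive_unique (fun x : R => b x) _ _ Hb),
  (is_derive_unique (fun x : R => c x) _ _ Hc), (is_derive_unique (fun x : R => e x) _ _ He).
ring.
Qed.

(** The squared modulus replaces the complex discriminant so that [linear_ode_zero] applies: it is
    real, nonnegative and vanishes exactly when the discriminant does. *)
Lemma Ramanujan_discriminant_neq_0 : Ramanujan_system ->
  forall tau, upper_half_plane tau -> E4 tau ^ 3 - E6 tau ^ 2 <> 0.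
Proof.
intros HR [x y0] Hy E; unfold upper_half_plane in Hy; simpl in Hy.
destruct discriminant_near_infinity as [eps [He Hinf]].
destruct (nome_small eps y0 He) as [y1 [Hy1 Hsmall]].
apply (Hinf (x, y1) (Hsmall x)).
set (d := fun y : R => E4 (x, y) ^ 3 - E6 (x, y) ^ 2).
assert (HN : (Re (d y1) ^ 2 + Im (d y1) ^ 2 = 0)%R).
(* Along the vertical line d' = i (2 pi i) E2 d = -2 pi E2 d, hence |d|^2 satisfies a linear
   equation with coefficient -4 pi Re E2. *)
{ apply (linear_ode_zero (fun y : R => Re (d y) ^ 2 + Im (d y) ^ 2)%R
    (fun y : R => - 4 * PI * Re (E2 (x, y)))%R y0 y1 Hy1).
  - intros y Hyy.
    destruct (HR (x, y) ltac:(unfold upper_half_plane; simpl; lra)) as [_ [H4 H6]].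
    destruct (is_derive_vertical _ _ _ _ H4) as [H4r H4i].
    destruct (is_derive_vertical _ _ _ _ H6) as [H6r H6i].
    apply (is_derive_ext (fun s : R =>
      (re_cube (Re (E4 (x, s))) (Im (E4 (x, s))) - re_sqr (Re (E6 (x, s))) (Im (E6 (x, s)))) ^ 2
      + (im_cube (Re (E4 (x, s))) (Im (E4 (x, s))) - im_sqr (Re (E6 (x, s))) (Im (E6 (x, s)))) ^ 2)%R).
    { intros s; unfold d; unfold re_cube, im_cube, re_sqr, im_sqr; change (AbsRing.sort R_AbsRing) with R in s.
      destruct (E4 (x, s)) as [a b], (E6 (x, s)) as [c e]; simpl; ring. }
    eapply eq_rect; [exact (is_derive_discriminant_norm2 _ _ _ _ y _ _ _ _ H4r H4i H6r H6i)|].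
    unfold d.
    destruct (E4 (x, y)) as [a b], (E6 (x, y)) as [c e], (E2 (x, y)) as [f g].
    unfold re_cube, im_cube, re_sqr, im_sqr; simpl; field.
  - intros y Hyy.
    destruct (HR (x, y) ltac:(unfold upper_half_plane; simpl; lra)) as [H2 _].
    destruct (is_derive_vertical _ _ _ _ H2) as [H2r _].
    apply continuity_pt_mult; [apply continuity_pt_const; now intros ? ?|].
    apply derivable_continuous_pt; eexists; apply is_derive_Reals; exact H2r.
  - intros y _; pose proof (pow2_ge_0 (Re (d y))); pose proof (pow2_ge_0 (Im (d y))); lra.
  - unfold d; rewrite E; simpl; ring. }
fold (d y1).
pose proof (pow2_ge_0 (Re (d y1))); pose proof (pow2_ge_0 (Im (d y1))).
apply Cmod_eq_0.
assert (H2 : (Cmod (d y1) ^ 2 = 0)%R) by (rewrite Cmod2_alt; exact HN).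
nra.
Qed.

(** * Integral curves *)

Lemma is_qderive_scal (k : C) (f : C -> C) (tau l : C) :
  is_qderive f tau l -> is_qderive (fun z => k * f z) tau (k * l).
Proof.
intros H; unfold is_qderive, is_derive in *.
apply (filterdiff_ext_lin (U := AbsRing_NormedModule C_AbsRing) (V := C_NormedModule) _
  (fun y => scal k (scal y (2 * RtoC PI * Ci * l)))).
- exact (filterdiff_scal_r_fct (U := AbsRing_NormedModule C_AbsRing) (V := C_NormedModule) k f _ Cmult_comm H).
- intros y; unfold scal; simpl; unfold mult; simpl; ring.
Qed.

Lemma is_qderive_scal_iff (k : C) (f g : C -> C) (tau l m : C) : k <> 0 ->
  (forall z, g z = f z / k) -> m = l / k ->
  is_qderive g tau m <-> is_qderive f tau l.
Proof.
intros Hk Hg ->; split; intros H.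
- apply (is_qderive_scal k) in H.
  replace (k * (l / k)) with l in H by (field; exact Hk).
  refine (is_derive_ext _ _ _ _ _ H).
  intros z; rewrite Hg; unfold C_NormedModule; simpl; field; exact Hk.
- apply (is_qderive_scal (/ k)) in H.
  replace (/ k * l) with (l / k) in H by (field; exact Hk).
  refine (is_derive_ext _ _ _ _ _ H).
  intros z; rewrite Hg; unfold C_NormedModule; simpl; field; exact Hk.
Qed.

(** By the explicit formula for v, scaling its components at Phi(tau) by 12, 12 and 216 gives the
    three right-hand sides of the Ramanujan system. *)
Lemma Phi_derivatives_iff v p tau : is_Ramanujan_vector_field v ->
  Phi tau = (t1 p, t2 p, t3 p) ->
  (is_qderive (fun z => fst (fst (Phi z))) tau (v1 v p) /\
   is_qderive (fun z => snd (fst (Phi z))) tau (v2 v p) /\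
   is_qderive (fun z => snd (Phi z)) tau (v3 v p)) <->
  (is_qderive E2 tau ((E2 tau ^ 2 - E4 tau) / 12) /\
   is_qderive E4 tau ((E2 tau * E4 tau - E6 tau) / 3) /\
   is_qderive E6 tau ((E2 tau * E6 tau - E4 tau ^ 2) / 2)).
Proof.
intros Hv HP; unfold Phi in HP; injection HP as H1 H2 H3.
destruct (Ramanujan_vector_field_formula v p Hv) as [F1 [F2 F3]].
rewrite <- H1, <- H2, <- H3 in *.
assert (N12 : RtoC 12 <> 0) by (intros K; apply RtoC_inj in K; lra).
assert (N216 : RtoC 216 <> 0) by (intros K; apply RtoC_inj in K; lra).
rewrite (is_qderive_scal_iff 12 E2 (fun z => fst (fst (Phi z))) tau
  ((E2 tau ^ 2 - E4 tau) / 12)); [|exact N12|reflexivity|rewrite F1; field].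
rewrite (is_qderive_scal_iff 12 E4 (fun z => snd (fst (Phi z))) tau
  ((E2 tau * E4 tau - E6 tau) / 3)); [|exact N12|reflexivity|rewrite F2; field].
rewrite (is_qderive_scal_iff 216 E6 (fun z => snd (Phi z)) tau
  ((E2 tau * E6 tau - E4 tau ^ 2) / 2)); [|exact N216|reflexivity|rewrite F3; field].
reflexivity.
Qed.

Theorem proposition10 :
  forall v : vector_field, is_Ramanujan_vector_field v ->
    (Ramanujan_system <-> is_integral_curve v Phi).
Proof.
intros v Hv; split; intros H tau Htau.
(* An integral curve must land in [T]: the discriminant at Phi(tau) is -(E4^3 - E6^2) / 1728,
   nonzero by the system itself. *)
- assert (Hd : 27 * (E6 tau / 216) ^ 2 - (E4 tau / 12) ^ 3 <> 0).
  { intros E; apply (Ramanujan_discriminant_neq_0 H tau Htau).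
    replace (E4 tau ^ 3 - E6 tau ^ 2)
      with (-1728 * (27 * (E6 tau / 216) ^ 2 - (E4 tau / 12) ^ 3)) by field.
    rewrite E; ring. }
  exists (mkT (E2 tau / 12) (E4 tau / 12) (E6 tau / 216) Hd).
  split; [reflexivity|].
  apply Phi_derivatives_iff; [exact Hv|reflexivity|now apply H].
- destruct (H tau Htau) as [p [Hp Hder]].
  now apply (Phi_derivatives_iff v p tau Hv Hp).
Qed.
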